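(* Let $m,m'\ge0$ and $n\ge0$. If $m$ is odd, then for every $m'\ge0$, \[ u_m(u_{m'}(n))=2u_{m'}(n)+1-c_m(n),\quad v_m(v_{m'}(n))=2v_{m'}(n)+c_m(n), \] \[ u_m(v_{m'}(n))=2v_{m'}(n)+1-c_m(n),\quad v_m(u_{m'}(n))=2u_{m'}(n)+c_m(n). \] If $m\ge2$ is even, then \[ u_m(u_{m'}(n))=2u_{m'}(n)+\gamma_{m,m'}(n),\quad v_m(v_{m'}(n))=2v_{m'}(n)+\gamma_{m,m'}(n), \] \[ u_m(v_{m'}(n))=2v_{m'}(n)+1-\gamma_{m,m'}(n),\quad v_m(u_{m'}(n))=2u_{m'}(n)+1-\gamma_{m,m'}(n). \]
   Context: For $n\ge0$ write $b_p(n)=\lfloor n/2^p\rfloor\bmod 2$; $\oplus$ is XOR and $\&$ is bitwise AND. For $m\ge0$ let $a_m(n)=\bigoplus_{p\ge0,\ p\,\&\,m=0} b_p(n)$. Let $v_m(n)$ (resp. $u_m(n)$), $n\ge0$, be the $n$-th (indexing from $0$) nonnegative integer, in increasing order, at which $a_m$ equals $0$ (resp. $1$). Define $\gamma_{m,m'}(n)=a_m(4n)\oplus a_{m'}(2n)$. Let $K(m)=\max(1,\lceil\log_2(m+1)\rceil)$. The correction set $C(m)\subseteq\mathbb N$ is defined recursively: $C(0)=\emptyset$; for odd $m\ge1$, with $K=K(m)$ and $r=m-2^{K-1}$, $C(m)$ is periodic with period $2^K$ and $C(m)\cap[0,2^K)=\{2^K-2\}\cup(C(r)\cap[0,2^{K-1}-2))$;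 for even $m\ge2$, $C(m)=C(m-1)$. Set $c_m(n)=\bigoplus_{p\in C(m)}b_p(n)$. *)

(* Defs.v *)
From mathcomp Require Import all_boot.

Set Implicit Arguments.
Unset Strict Implicit.
Unset Printing Implicit Defensive.

(* Bits are booleans, coerced to 0 and 1 in arithmetic expressions. *)
Definition bit (p n : nat) : bool := odd (n %/ 2 ^ p).

(* The XOR over all p >= 0 with P p; since n < 2 ^ n, the bits of n at
   positions p >= n vanish (see xor_bits_widen). *)
Definition xor_bits (P : pred nat) (n : nat) : bool :=
  \big[addb/false]_(p < n | P p) bit p n.

Lemma bit_small p n : n <= p -> bit p n = false.
Proof.
move=> le_np; rewrite /bit divn_small //.
by apply: leq_ltn_trans le_np _; apply: ltn_expl.
Qed.

Lemma xor_bits_widen (P : pred nat) (n N : nat) : n <= N ->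
  xor_bits P n = \big[addb/false]_(p < N | P p) bit p n.
Proof.
move=> le_nN; rewrite /xor_bits -!(big_mkord P (bit^~ n)).
rewrite (big_cat_nat (n := n) (p := N)) //= [X in _ (+) X]big_nat_cond.
rewrite [X in _ (+) X]big1 ?addbF // => p /andP[/andP[le_np _] _].
exact: bit_small.
Qed.

Definition aseq (m n : nat) : bool := xor_bits (fun p => Nat.land p m == 0) n.

(* Position 0 always contributes to aseq, so aseq m takes both values on
   each pair {2k, 2k + 1}; in particular each value is taken infinitely often. *)
Lemma aseq_double m k : aseq m k.*2.+1 = ~~ aseq m k.*2.
Proof.
rewrite /aseq !(@xor_bits_widen _ _ k.*2.+1) //.
rewrite big_mkcond [in RHS]big_mkcond !big_ord_recl /=.
rewrite /bit expn0 !divn1 /= odd_double /=; congr (~~ _).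
apply: eq_bigr => i _; case: ifP => // _.
by rewrite /= /bump /= add1n expnS !divnMA !divn2 /= uphalf_double doubleK.
Qed.

Lemma aseq_infinite m (e : bool) N : exists x, (N <= x) && (aseq m x == e).
Proof.
have le_N2 : N <= N.*2 by rewrite -addnn leq_addr.
case: (boolP (aseq m N.*2 == e)) => [ae|ane]; first by exists N.*2; rewrite le_N2.
exists N.*2.+1; rewrite leqW //= aseq_double.
by move: ane; case: (aseq _ _); case: e.
Qed.

(* The increasing enumeration, indexed from 0, of an infinite set of naturals. *)
Fixpoint enum_inf (P : pred nat) (infP : forall N, exists x, (N <= x) && P x)
    (n : nat) : nat :=
  if n is k.+1 then ex_minn (infP (enum_inf infP k).+1) else ex_minn (infP 0).

Definition vseq (m n : nat) : nat := enum_inf (aseq_infinite m false) n.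
Definition useq (m n : nat) : nat := enum_inf (aseq_infinite m true) n.

Definition gammaseq (m m' n : nat) : bool :=
  aseq m (4 * n) (+) aseq m' (2 * n).

Definition Kexp (m : nat) : nat := maxn 1 (up_log 2 m.+1).

(* Membership of p in C(m). The recursive calls are on smaller values of m, so
   fuel m suffices (see corr_odd_periodic, corr_odd_base, corr_even). For
   K = 1 the truncated bound 2 ^ (K - 1) - 2 is 0, and the interval is empty as
   it should be. *)
Fixpoint corr_rec (fuel m p : nat) : bool :=
  if fuel is k.+1 then
    if m == 0 then false
    else if odd m then
      let K := Kexp m in
      let q := p %% 2 ^ K in
      (q == 2 ^ K - 2) ||
        (corr_rec k (m - 2 ^ (K - 1)) q && (q < 2 ^ (K - 1) - 2))
    else corr_rec k (m - 1) p
  else false.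

Definition corr (m p : nat) : bool := corr_rec m m p.

Lemma corr_recS k m p : 0 < m -> corr_rec k.+1 m p =
  if odd m then
    (p %% 2 ^ Kexp m == 2 ^ Kexp m - 2) ||
      (corr_rec k (m - 2 ^ (Kexp m - 1)) (p %% 2 ^ Kexp m) &&
         (p %% 2 ^ Kexp m < 2 ^ (Kexp m - 1) - 2))
  else corr_rec k (m - 1) p.
Proof. by case: m. Qed.

Lemma leq_subS m d k : m <= k.+1 -> 0 < d -> m - d <= k.
Proof.
move=> lemk d0; rewrite leq_subLR; apply: leq_trans lemk _.
by rewrite -add1n leq_add2r.
Qed.

Lemma corr_rec_fuel k m p : m <= k -> corr_rec k m p = corr m p.
Proof.
move=> lemk; rewrite /corr; have := leqnn m; move: {2 4}m => k'.
elim: k k' m p lemk => [|k IHk] [|k'] [|m] // p lemk lemk'.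
by rewrite !corr_recS // !(IHk k') ?leq_subS ?expn_gt0.
Qed.

Lemma corr_0 p : corr 0 p = false. Proof. by []. Qed.

Lemma corrE m p : 0 < m -> corr m p =
  if odd m then
    (p %% 2 ^ Kexp m == 2 ^ Kexp m - 2) ||
      (corr (m - 2 ^ (Kexp m - 1)) (p %% 2 ^ Kexp m) &&
         (p %% 2 ^ Kexp m < 2 ^ (Kexp m - 1) - 2))
  else corr (m - 1) p.
Proof.
move=> m0; rewrite -(@corr_rec_fuel m.+1) // corr_recS //.
by rewrite !corr_rec_fuel ?leq_subr.
Qed.

Lemma corr_odd_periodic m p : odd m -> corr m (p + 2 ^ Kexp m) = corr m p.
Proof. by move=> om; rewrite [LHS]corrE ?[RHS]corrE ?odd_gt0 // om modnDr. Qed.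

Lemma corr_odd_base m p : odd m -> p < 2 ^ Kexp m ->
  corr m p = (p == 2 ^ Kexp m - 2) ||
    (corr (m - 2 ^ (Kexp m - 1)) p && (p < 2 ^ (Kexp m - 1) - 2)).
Proof. by move=> om ltp; rewrite corrE ?odd_gt0 // om modn_small. Qed.

Lemma corr_even m p : 0 < m -> ~~ odd m -> corr m p = corr (m - 1) p.
Proof. by move=> m0 em; rewrite corrE // (negbTE em). Qed.

Definition cseq (m n : nat) : bool := xor_bits (corr m) n.

(* Main.v *)
Require Import Defs.
From Stdlib Require Import PeanoNat.
From mathcomp Require Import all_boot zify.

(** Each pair {2k, 2k+1} contains exactly one zero and one one of a_m, so
    v_m(k) = 2k + a_m(2k) and u_m(k) = 2k + 1 - a_m(2k). Hence everything
    reduces to a_m(2x) for x = 2n + e with e a bit. Shifting positions twice,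
    a_m(2x) = a_m(4n) when m is odd (position 1 meets m), while
    a_m(2x) = e (+) a_m(4n) when m is even. Finally, for odd m the recursion
    defining C(m) describes {q | (q + 2) & m = 0}, so a_m(4n) = c_m(n). *)

Lemma Nat_oddE n : Nat.odd n = odd n.
Proof.
suff H k : Nat.even k = ~~ odd k by rewrite /Nat.odd H negbK.
suff /andP[/eqP //] : (Nat.even k == ~~ odd k) && (Nat.even k.+1 == ~~ odd k.+1).
elim: k => // k /andP[/eqP e1 /eqP e2]; rewrite e2 eqxx /=.
by rewrite e1 negbK.
Qed.

Lemma Nat_div2E n : Nat.div2 n = n./2.
Proof.
suff /andP[/eqP //] : (Nat.div2 n == n./2) && (Nat.div2 n.+1 == n.+1./2).
by elim: n => // n /andP[/eqP e1 /eqP e2]; rewrite e2 eqxx /= e1.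
Qed.

Lemma land_eq0_half x y :
  (Nat.land x y == 0) = ~~ (odd x && odd y) && (Nat.land x./2 y./2 == 0).
Proof.
have <- : odd (Nat.land x y) = odd x && odd y.
  by rewrite -!Nat_oddE -!Nat.bit0_odd Nat.land_spec.
have <- : (Nat.land x y)./2 = Nat.land x./2 y./2.
  by rewrite -!Nat_div2E; exact: (Nat.shiftr_land x y 1).
lia.
Qed.

(** The blocks of bits below and above position [k] do not interact; induction on [k] peels off the
    lowest bit. This serves both to reduce modulo [2 ^ K] and to detach the leading bit of [m]. *)
Lemma land_eq0_split k a b x y : x < 2 ^ k -> y < 2 ^ k ->
  (Nat.land (a * 2 ^ k + x) (b * 2 ^ k + y) == 0) =
    (Nat.land a b == 0) && (Nat.land x y == 0).
Proof.
elim: k x y => [|k IHk] x y ltx lty.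
  have -> : x = 0 by lia.
  have -> : y = 0 by lia.
  by rewrite !muln1 !addn0 andbT.
have halfE c z : (c * 2 ^ k.+1 + z)./2 = c * 2 ^ k + z./2.
  by rewrite expnS; lia.
have oddE c z : odd (c * 2 ^ k.+1 + z) = odd z.
  by rewrite oddD oddM oddX andbF.
rewrite land_eq0_half !oddE !halfE IHk; try by rewrite expnS in ltx lty; lia.
by rewrite [in RHS](land_eq0_half x y) andbCA.
Qed.

Lemma Kexp_gt0 m : 0 < Kexp m. Proof. by rewrite leq_max. Qed.

Lemma Kexp_bounds m : 0 < m -> 2 ^ (Kexp m - 1) <= m < 2 ^ Kexp m.
Proof.
move=> m0; have lo : 0 < up_log 2 m.+1 by rewrite up_log_gt0.
rewrite /Kexp (maxn_idPr lo) subn1 -[2 ^ _ <= m]ltnS.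
exact: up_log_bounds.
Qed.

Lemma corr_oddE m q : odd m -> corr m q = (Nat.land (q + 2) m == 0).
Proof.
elim/ltn_ind: m q => m IHm q om; have m0 := odd_gt0 om.
have /andP[lem ltm] := Kexp_bounds m m0.
rewrite corrE // om.
have := Kexp_gt0 m; case: (Kexp m) lem ltm => // k; rewrite subn1 /= => lem ltm _.
have k0 : 0 < 2 ^ k by rewrite expn_gt0.
have landD c z : z < 2 ^ k.+1 -> (Nat.land (c * 2 ^ k.+1 + z) m == 0) = (Nat.land z m == 0).
  move=> ltz; have := land_eq0_split k.+1 c 0 z m ltz ltm.
  by rewrite Nat.land_0_r.
rewrite [in RHS](divn_eq q (2 ^ k.+1)).
have := ltn_pmod q (expn_gt0 2 k.+1); move: (q %/ _) (q %% _) => c {}q ltq.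
have eK : 2 ^ k.+1 = 2 ^ k + 2 ^ k by rewrite expnS mul2n addnn.
(* From here [q] is the residue. If it is [2 ^ k.+1 - 2], adding 2 gives 0 modulo [2 ^ k.+1], which
   meets no bit of [m]. *)
case: (eqVneq q (2 ^ k.+1 - 2)) => [eq_q|ne_q] /=.
  have -> : c * 2 ^ k.+1 + q + 2 = c.+1 * 2 ^ k.+1 + 0 by lia.
  by rewrite landD // expn_gt0.
(* The only other residue that wraps around is [2 ^ k.+1 - 1]: it gives 1, which meets bit 0 of the
   odd [m]. *)
have [ltq2|leq2] := ltnP (q + 2) (2 ^ k.+1); last first.
  have -> : c * 2 ^ k.+1 + q + 2 = c.+1 * 2 ^ k.+1 + 1 by lia.
  rewrite landD; last by lia.
  by rewrite land_eq0_half om /=; lia.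
rewrite -addnA landD //.
have [ltq2'|leq2'] := ltnP (q + 2) (2 ^ k); last first.
  have -> : (q < 2 ^ k - 2) = false by lia.
  rewrite andbF.
  have -> : q + 2 = 1 * 2 ^ k + (q + 2 - 2 ^ k) by lia.
  have -> : m = 1 * 2 ^ k + (m - 2 ^ k) by lia.
  by rewrite land_eq0_split //; lia.
have -> : (q < 2 ^ k - 2) by lia.
(* Positivity of [k] makes [2 ^ k] even, so [m - 2 ^ k] is still odd and the induction hypothesis
   applies. *)
have k1 : 0 < k by case: (k) ltq2' => //; lia.
rewrite andbT IHm; [|by lia|by rewrite oddB // om oddX eqn0Ngt k1].
have := land_eq0_split k 0 1 (q + 2) (m - 2 ^ k) ltq2'.
have -> : 1 * 2 ^ k + (m - 2 ^ k) = m by lia.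
by rewrite mul0n add0n => -> //; lia.
Qed.

Lemma bitS p (e : bool) n : bit p.+1 (2 * n + e) = bit p n.
Proof. by rewrite /bit expnS divnMA divn2; do 2!f_equal; lia. Qed.

Lemma eq_xor_bits (P Q : pred nat) n : P =1 Q -> xor_bits P n = xor_bits Q n.
Proof. by move=> eqPQ; apply: eq_bigl => i; apply: eqPQ. Qed.

Lemma xor_bits_shift (P : pred nat) (e : bool) n :
  xor_bits P (2 * n + e) = (P 0 && e) (+) xor_bits (P \o succn) n.
Proof.
(* The ranges are chosen so that they agree once position 0 is split off on the left. *)
rewrite (@xor_bits_widen P _ (2 * n + e).+1) // (@xor_bits_widen _ n (2 * n + e)); last by lia.
rewrite big_mkcond [in RHS]big_mkcond big_ord_recl /=; congr (_ (+) _).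
  by rewrite /bit expn0 divn1 oddD mul2n odd_double oddb; case: (P 0).
by apply: eq_bigr => i _; rewrite bitS.
Qed.

Definition land_tail m : pred nat := fun q => Nat.land (q + 2) m == 0.

Lemma aseq_quad m (e : bool) n :
  aseq m (2 * (2 * n + e)) = (~~ odd m && e) (+) xor_bits (land_tail m) n.
Proof.
rewrite -[2 * _]addn0 /aseq (xor_bits_shift _ false) andbF addFb.
rewrite xor_bits_shift /= land_eq0_half /= andbT; congr (_ (+) _).
by apply: eq_xor_bits => q; rewrite /land_tail addn2.
Qed.

Lemma ex_minn_eq (P : pred nat) (exP : exists x, P x) x :
  P x -> (forall y, P y -> x <= y) -> ex_minn exP = x.
Proof.
move=> Px minx; case: ex_minnP => y Py miny.
by apply/eqP; rewrite eqn_leq miny // minx.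
Qed.

(** Each pair [{2k, 2k+1}] holds exactly one element of [P], so the element of index [n] lies in the
    pair of index [n]. *)
Lemma enum_infE (P : pred nat) (infP : forall N, exists x, (N <= x) && P x) :
  (forall k, P k.*2.+1 = ~~ P k.*2) ->
  forall n, enum_inf infP n = 2 * n + ~~ P (2 * n).
Proof.
move=> altP.
(* A search started at [N] lands in the pair of index [n] as soon as [P] has no element from [N] up
   to [2 * n]. *)
have stepP n N : (forall x, x < 2 * n -> P x -> x < N) -> N <= 2 * n ->
    ex_minn (infP N) = 2 * n + ~~ P (2 * n).
  move=> gapN leN; apply: ex_minn_eq.
    rewrite (leq_trans leN) ?leq_addr //=.
    have := altP n; rewrite -mul2n.
    by case: (boolP (P (2 * n))) => H; rewrite ?addn0 ?addn1.
  move=> y /andP[leNy Py].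
  have le2 : 2 * n <= y by rewrite leqNgt; apply/negP => /gapN/(_ Py); rewrite ltnNge leNy.
  case: (boolP (P (2 * n))) => H; rewrite ?addn0 ?addn1 //.
  by rewrite ltn_neqAle le2 andbT; apply: contraNneq H => ->.
elim=> [|n IHn]; first exact: (stepP 0).
rewrite [LHS]/= IHn; apply: stepP; last by case: (P _); lia.
move=> x ltx Px; case: (boolP (P (2 * n))) => [H|H] /=; last by lia.
rewrite addn0 ltnS leqNgt; apply/negP => lt2.
have ex : x = n.*2.+1 by lia.
by move: Px; rewrite ex altP -mul2n H.
Qed.

Lemma vseqE m n : vseq m n = 2 * n + aseq m (2 * n).
Proof.
rewrite /vseq (@enum_infE (fun x => aseq m x == false)).
  by case: (aseq _ _).
by move=> k; rewrite aseq_double; case: (aseq _ _).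
Qed.

Lemma useqE m n : useq m n = 2 * n + ~~ aseq m (2 * n).
Proof.
rewrite /useq (@enum_infE (fun x => aseq m x == true)).
  by rewrite eqb_id.
by move=> k; rewrite aseq_double; case: (aseq _ _).
Qed.

Theorem theorem34 (m m' n : nat) :
  (odd m ->
    [/\ useq m (useq m' n) = 2 * useq m' n + 1 - cseq m n,
        vseq m (vseq m' n) = 2 * vseq m' n + cseq m n,
        useq m (vseq m' n) = 2 * vseq m' n + 1 - cseq m n
      & vseq m (useq m' n) = 2 * useq m' n + cseq m n]) /\
  (2 <= m -> ~~ odd m ->
    [/\ useq m (useq m' n) = 2 * useq m' n + gammaseq m m' n,
        vseq m (vseq m' n) = 2 * vseq m' n + gammaseq m m' n,
        useq m (vseq m' n) = 2 * vseq m' n + 1 - gammaseq m m' n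
      & vseq m (useq m' n) = 2 * useq m' n + 1 - gammaseq m m' n]).
Proof.
have negE (b : bool) x : x + ~~ b = x + 1 - b by case: b; rewrite ?addn0 ?addnK ?subn0.
split=> [om|_ em].
  (* Both inner values have the form [2 * n + e], with opposite bits [e]; for odd [m] the bit has no
     effect. *)
  have aE (e : bool) : aseq m (2 * (2 * n + e)) = cseq m n.
    by rewrite aseq_quad om /=; apply: eq_xor_bits => q; rewrite corr_oddE.
  by split; rewrite ?(useqE m) ?(vseqE m) ?(useqE m') ?(vseqE m') !aE ?negE.
(* With [e] equal to [aseq m' (2 * n)] or its negation, the right side is [gammaseq m m' n] or its
   negation. *)
have aE (e : bool) : aseq m (2 * (2 * n + e)) = e (+) aseq m (4 * n).
  have := aseq_quad m false n; rewrite addn0 mulnA andbF addFb => ->.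
  by rewrite aseq_quad em.
by split; rewrite ?(useqE m) ?(vseqE m) ?(useqE m') ?(vseqE m') !aE -?negE /gammaseq;
  case: (aseq m _); case: (aseq m' _).
Qed.
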